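(* Let $n\ge1$ and let $\alpha=(\alpha_1,\dots,\alpha_L)$ be a (weak) composition. The maps $\widetilde F_i$ and $\widetilde R_i$ commute with the involutions $\sigma_j$: for every $\mathbf{D}\in\mathrm{bMLQ}(\alpha,n)$, every $1\le i\le n$ and every $1\le j<L$, $$\sigma_j\bigl(\widetilde F_i(\mathbf{D})\bigr)=\widetilde F_i\bigl(\sigma_j(\mathbf{D})\bigr)\qquad\text{and}\qquad \sigma_j\bigl(\widetilde R_i(\mathbf{D})\bigr)=\widetilde R_i\bigl(\sigma_j(\mathbf{D})\bigr).$$
   Context: Fix $n\ge1$; sites are $\mathbb{Z}_n=\{1,\dots,n\}$, considered cyclically. $\mathcal{M}(n)$ is the set of finite multisets with entries in $[n]=\{1,\dots,n\}$. $\mathrm{bMLQ}(\alpha,n)$ is the set of bosonic multiline queues of type $(\alpha,n)$: tuples $\mathbf{D}=(D_1,\dots,D_L)$ with $D_j\in\mathcal{M}(n)$ and $|D_j|=\alpha_j$ (row 1 is the bottom row). Pairing. For $A,B\in\mathcal{M}(n)$ ($A$ the lower row, $B$ the upper row), $\mathrm{cpair_b}(A,B)$ is: for $j=1,\dots,n$ in order, write '')'' once for each instance of $j$ in $B$ and then ''('' once for each instance of $j$ in $A$; view the bracket word on a circle and recursively match each ''('' with a '')'' following it cyclically when there are no unmatched brackets between them. A particle is paired (unpaired) if its bracket is matched (unmatched). Involution $\sigma_j$: acts on $\mathbf{D}$ by moving all particles unpaired in $\mathrm{cpair_b}(D_j,D_{j+1})$ from row $j$ to row $j+1$ and from row $j+1$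 to row $j$ (keeping their sites). Forward map: for $i\in\mathbb{Z}_n$ let $\mathfrak{a}_1=i$ and, for $2\le j\le L+1$, $\mathfrak{a}_j=\mathfrak{a}_{j-1}$ if $\mathfrak{a}_{j-1}\notin D_{j-1}$ and $\mathfrak{a}_j=\mathfrak{a}_{j-1}+1$ otherwise. Then $\widetilde F_i(\mathbf{D})=(D_1',\dots,D_L')$ where $D_j'=D_j$ if $\mathfrak{a}_j\notin D_j$, and otherwise $D_j'$ is $D_j$ with one copy of $\mathfrak{a}_j$ replaced by $\mathfrak{a}_j+1$. Reverse map: for $i\in\mathbb{Z}_n$ let $\mathfrak{b}_L=i$ and, for $j=L-1,\dots,0$, $\mathfrak{b}_j=\mathfrak{b}_{j+1}$ if $\mathfrak{b}_{j+1}+1\notin D_{j+1}$ and $\mathfrak{b}_j=\mathfrak{b}_{j+1}-1$ otherwise. Then $\widetilde R_i(\mathbf{D})=(D_1'',\dots,D_L'')$ where $D_j''=D_j$ if $\mathfrak{b}_j+1\notin D_j$, and otherwise $D_j''$ is $D_j$ with one copy of $\mathfrak{b}_j+1$ replaced by $\mathfrak{b}_j$. *)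

(* Defs.v *)
From mathcomp Require Import all_boot.
From mathcomp Require Import finmap multiset.

Set Implicit Arguments.
Unset Strict Implicit.
Unset Printing Implicit Defensive.

Local Open Scope mset_scope.
Local Open Scope nat_scope.

(** Conventions.  The cyclic sites 1, ..., n are the ordinals 0, ..., n-1 of
    ['I_n], in the same order; the site after (before) [i] is [ordS i]
    ([ord_pred i]), which wraps around.  Rows are numbered 1, ..., L from the
    bottom, so row [j] is entry [j.-1] of the tuple. *)

Definition bMLQ (L : nat) (alpha : L.-tuple nat) (n : nat) :
    pred (L.-tuple {mset 'I_n}) :=
  fun D => [forall k, size (tnth D k) == tnth alpha k].

Arguments bMLQ {L} alpha n _.

Section Rows.
Variables (n L : nat).
Implicit Types (A B : {mset 'I_n}) (D : L.-tuple {mset 'I_n}).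

Definition mlq_row D (j : nat) : {mset 'I_n} := nth mset0 D j.-1.

(** A bracket [(b, s)] comes from a particle at site [s]: it is "(", from the
    lower row, if [b] is true and ")", from the upper row, if [b] is false. *)
Definition bracket_word A B : seq (bool * 'I_n) :=
  flatten [seq nseq (B s) (false, s) ++ nseq (A s) (true, s) | s <- enum 'I_n].

Definition starts_with_pair (w : seq (bool * 'I_n)) : bool :=
  if w is (true, _) :: (false, _) :: _ then true else false.

(** The word of the brackets that are still unmatched, up to rotation: if some
    "(" is followed cyclically by ")" with no unmatched bracket in between,
    i.e. if some rotation starts with "()", these two are matched. *)
Definition match_step (w : seq (bool * 'I_n)) : seq (bool * 'I_n) :=
  let k := find (fun k => starts_with_pair (rot k w)) (iota 0 (size w)) in
  if k < size w then drop 2 (rot k w) else w.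

(** Each effective step removes two brackets, so [size w] steps are enough;
    see [unmatchedP]. *)
Definition unmatched (w : seq (bool * 'I_n)) : seq (bool * 'I_n) :=
  iter (size w) match_step w.

Definition unpaired_lower A B : {mset 'I_n} :=
  seq_mset [seq c.2 | c <- unmatched (bracket_word A B) & c.1].

Definition unpaired_upper A B : {mset 'I_n} :=
  seq_mset [seq c.2 | c <- unmatched (bracket_word A B) & ~~ c.1].

Definition sigma (j : nat) D : L.-tuple {mset 'I_n} :=
  let A := mlq_row D j in
  let B := mlq_row D j.+1 in
  let uA := unpaired_lower A B in
  let uB := unpaired_upper A B in
  [tuple if k.+1 == j then (A `\` uA) `+` uB
         else if k.+1 == j.+1 then (B `\` uB) `+` uA
         else mlq_row D k.+1 | k < L].

(** [A] with one copy of [s] replaced by [t], provided that [s] is in [A]. *)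
Definition move_one A (s t : 'I_n) : {mset 'I_n} :=
  if s \in A then t +` (A `\ s) else A.

(** [fwd_site i D j] is a_j for 1 <= j <= L+1: a_1 = i, and a_j is obtained
    from a_(j-1) by means of row j-1. *)
Definition fwd_site (i : 'I_n) D (j : nat) : 'I_n :=
  foldl (fun a A => if a \in A then ordS a else a) i (take j.-1 D).

Definition Ftilde (i : 'I_n) D : L.-tuple {mset 'I_n} :=
  [tuple let a := fwd_site i D k.+1 in
         move_one (mlq_row D k.+1) a (ordS a) | k < L].

(** [rev_site i D j] is b_j for 0 <= j <= L: b_L = i, and b_j is obtained
    from b_(j+1) by means of row j+1. *)
Definition rev_site (i : 'I_n) D (j : nat) : 'I_n :=
  foldr (fun A b => if ordS b \in A then ord_pred b else b) i (drop j D).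

Definition Rtilde (i : 'I_n) D : L.-tuple {mset 'I_n} :=
  [tuple let b := rev_site i D k.+1 in
         move_one (mlq_row D k.+1) (ordS b) b | k < L].

Lemma match_stepP w :
  (forall k, ~~ starts_with_pair (rot k w)) /\ match_step w = w
  \/ size (match_step w) < size w.
Proof.
rewrite /match_step; set p := (fun k => _); case: ifP => [lt_k|ge_k].
  right; rewrite size_drop size_rot.
  by case: (size w) lt_k => // m _; rewrite subSS ltnS leq_subr.
left; split=> // k; have nop k0 : k0 < size w -> ~~ p k0.
  move=> lt_k0; suff /hasPn : ~~ has p (iota 0 (size w)).
    by apply; rewrite mem_iota.
  by rewrite has_find size_iota ge_k.
case: (ltnP k (size w)) => [/nop //|le_k]; rewrite rot_oversize //.
by case: (posnP (size w)) => [/size0nil -> //|/nop]; rewrite /p rot0.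
Qed.

Lemma unmatchedP w k : ~~ starts_with_pair (rot k (unmatched w)).
Proof.
rewrite /unmatched; have := leqnn (size w); move: {2 3}(size w) => m; elim: m w => [|m IHm] w.
  by rewrite leqn0 => /nilP ->.
move=> le_m; rewrite iterSr; case: (match_stepP w) => [[w_irr w_fix]|lt_w].
  by rewrite !w_fix iter_fix.
by apply: IHm; rewrite -ltnS (leq_trans lt_w).
Qed.

End Rows.

(* Main.v *)
Require Import Defs.
From mathcomp Require Import all_boot.
From mathcomp Require Import finmap multiset.
From mathcomp Require Import zify.

Set Implicit Arguments.
Unset Strict Implicit.
Unset Printing Implicit Defensive.

(** Both maps send a travelling site through the rows one after the other, and
    [sigma j] changes two adjacent rows only.  So all happens in two rows, [A]
    (lower) and [B] (upper), which [sigma] turns into [A'] and [B']: the site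
    must leave the two rows at the same place before and after the exchange,
    and moving the particles must commute with the exchange.

    Read the bracket word around the circle as a queue: an opening bracket is a
    customer that arrives, a closing bracket is a service, and a service that
    finds no customer is idle.  Matched pairs are the customers served.  If the
    closing brackets are at least as many as the opening ones, there is a
    stationary queue length [q], and the unpaired particles are the idle
    services, so that
      [q s = A s + (q (s-1) - B s)], [B' s = min (B s) (q (s-1))] and
      [A' s + B' s = A s + B s],
    where the subtraction is truncated.  This is the relation [queue_swap].  In
    the other case the word read backwards gives [queue_swap A' B' A B].

    Three facts about [queue_swap] give the theorem for [Ftilde].  It holds
    between the two rows and their exchange, in one direction or the other
    ([queue_swap_rows]).  It determines the exchange in both directions
    ([queue_swapE]): the queue recursion is 1-Lipschitz, so two stationary
    solutions have a constant distance around the circle, and where they differ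
    no service is idle.  Finally, it is preserved when the same site travels
    through [A], [B] and through [A'], [B'] ([queue_swap_hop]): the queue length
    has to be corrected only at the site of entry and at the one after it.

    For [Rtilde] nothing has to be redone, because its action on two rows is
    inverse to that of [Ftilde] ([hop_unhop], [unhop_hop]). *)

(** * Bracket words as cyclic queues *)

Section Words.
Variable n : nat.
Implicit Types (w : seq (bool * 'I_n)) (s : 'I_n) (q : nat).

(** Opening brackets are arrivals and closing brackets are services; the
    predecessor of zero is zero, so a service of the empty queue does nothing. *)
Definition final_queue q w : nat :=
  foldl (fun q c => if c.1 then q.+1 else q.-1) q w.

Fixpoint idle_services q w : seq 'I_n :=
  if w is c :: w' then
    if c.1 then idle_services q.+1 w'
    else (if q is 0 then [:: c.2] else [::]) ++ idle_services q.-1 w'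
  else [::].

(** A stationary queue around the circle.  The idle services are recorded only
    up to a permutation, because rotating the word rotates them. *)
Definition cyclic_queue w (u : seq 'I_n) : Prop :=
  exists2 q, final_queue q w = q & perm_eq (idle_services q w) u.

(** Reading backwards exchanges the roles of the brackets, and sends the matched
    pairs of a word to those of the reversed one. *)
Definition reverse_word w : seq (bool * 'I_n) :=
  rev [seq (~~ c.1, c.2) | c <- w].

Definition site_word (A B : 'I_n -> nat) (ss : seq 'I_n) :=
  flatten [seq nseq (B s) (false, s) ++ nseq (A s) (true, s) | s <- ss].

Lemma final_queue_cat q w1 w2 :
  final_queue q (w1 ++ w2) = final_queue (final_queue q w1) w2.
Proof. exact: foldl_cat. Qed.

Lemma idle_services_cat q w1 w2 :
  idle_services q (w1 ++ w2) =
  idle_services q w1 ++ idle_services (final_queue q w1) w2.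
Proof.
elim: w1 q => [|[[] s] w1 IH] q //=.
by rewrite IH catA.
Qed.

Lemma cyclic_queue_swap w1 w2 u :
  cyclic_queue (w1 ++ w2) u -> cyclic_queue (w2 ++ w1) u.
Proof.
case=> q; rewrite final_queue_cat idle_services_cat => qK qu.
exists (final_queue q w1); first by rewrite final_queue_cat qK.
by rewrite idle_services_cat qK perm_catC.
Qed.

(** A customer served at once changes neither the queue nor the idleness. *)
Lemma cyclic_queue_pair w s1 s2 u :
  cyclic_queue w u -> cyclic_queue [:: (true, s1), (false, s2) & w] u.
Proof. by case=> q qK qu; exists q. Qed.

Lemma match_step_cases w :
  match_step w = w \/
  exists k s1 s2, rot k w = [:: (true, s1), (false, s2) & match_step w].
Proof.
rewrite /match_step; set p := (fun k => _); case: ifP => [lt_k|_]; last by left.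
right; have: has p (iota 0 (size w)) by rewrite has_find size_iota.
move/(nth_find 0); rewrite nth_iota // add0n /p.
move: (find _ _) => k.
case rotw: (rot k w) => [|[[] s1] [|[[] s2] r]] //= _.
by exists k, s1, s2; rewrite drop0.
Qed.

(** Matching only rotates the word and erases an adjacent pair, so a property
    that survives the inverse operations passes from the unmatched brackets back
    to the whole word. *)
Lemma match_step_invariant (P : seq (bool * 'I_n) -> Prop) :
    (forall w1 w2, P (w1 ++ w2) -> P (w2 ++ w1)) ->
    (forall w s1 s2, P w -> P [:: (true, s1), (false, s2) & w]) ->
  forall w, P (unmatched w) -> P w.
Proof.
move=> Pswap Ppair w; rewrite /unmatched.
move: (size w) => m; elim: m w => [|m IH] v //; rewrite iterSr => /IH.
case: (match_step_cases v) => [-> // | [k [s1 [s2 rotv]]] Pv].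
rewrite -(cat_take_drop k v); apply: Pswap.
by rewrite -/(rot k v) rotv; apply: Ppair.
Qed.

Lemma cyclic_queue_unmatched w u :
  cyclic_queue (unmatched w) u -> cyclic_queue w u.
Proof.
apply: (match_step_invariant (P := fun w => cyclic_queue w u)).
  by move=> w1 w2; apply: cyclic_queue_swap.
by move=> v s1 s2; apply: cyclic_queue_pair.
Qed.

Lemma reverse_word_cat w1 w2 :
  reverse_word (w1 ++ w2) = reverse_word w2 ++ reverse_word w1.
Proof. by rewrite /reverse_word map_cat rev_cat. Qed.

Lemma cyclic_queue_reverse_unmatched w u :
  cyclic_queue (reverse_word (unmatched w)) u ->
  cyclic_queue (reverse_word w) u.
Proof.
apply: (match_step_invariant (P := fun w => cyclic_queue (reverse_word w) u)).
  by move=> w1 w2; rewrite !reverse_word_cat; apply: cyclic_queue_swap.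
move=> v s1 s2 cq; rewrite -(cat1s _ (_ :: v)) -(cat1s (false, s2)) catA.
rewrite reverse_word_cat.
by apply: cyclic_queue_swap; apply: cyclic_queue_pair.
Qed.

Lemma drop_starts_with_pair s w :
  ~~ all fst w -> exists k, starts_with_pair (drop k ((true, s) :: w)).
Proof.
elim: w s => [|[[] t] w IH] s //=; last by exists 0.
by case/(IH t) => k hk; exists k.+1.
Qed.

(** If both kinds of brackets were left, then going around the circle from an
    opening bracket one would reach an opening bracket followed by a closing
    one, and matching would not be over. *)
Lemma unmatched_uniform w :
  all fst (unmatched w) \/ all (predC fst) (unmatched w).
Proof.
case: (boolP (all (predC fst) (unmatched w))) => [|/allPn[c cw /negPn cT]]; [by right|left].
have: has fst (unmatched w) by apply/hasP; exists c.
move: (@unmatchedP n w); move: (unmatched w) => r /[swap].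
case/split_find => [[[] s] r1 r2] // _ _ irr; apply: contraT.
set v := r2 ++ r1 => nall.
have: ~~ all fst v.
  by apply: contraNN nall; rewrite /v cat_rcons !all_cat /= andbC.
case/(drop_starts_with_pair s) => k.
have <- : rot (size r1) (rcons r1 (true, s) ++ r2) = (true, s) :: v.
  by rewrite cat_rcons rot_size_cat.
set r' := rcons _ _ ++ _ => pair_k.
have: starts_with_pair (rot k (rot (size r1) r')).
  move: pair_k; rewrite [rot k _]/rot.
  by case: (drop k _) => [|[[] t] [|[[] t'] r'']].
by rewrite rot_rot_add (negPf (irr _)).
Qed.
End Words.

(** * From words to queue lengths at the sites *)

Section SiteWords.
Variable n : nat.
Implicit Types (A B f g : 'I_n -> nat) (s : 'I_n) (q : nat) (ss : seq 'I_n).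

Lemma final_queue_block q a b s :
  final_queue q (nseq b (false, s) ++ nseq a (true, s)) = a + (q - b).
Proof.
rewrite final_queue_cat; elim: b q => [|b IH] q /=; last by rewrite IH; lia.
rewrite subn0; elim: a q => [|a IH] q //=; rewrite IH; lia.
Qed.

Lemma idle_services_block q a b s :
  idle_services q (nseq b (false, s) ++ nseq a (true, s)) = nseq (b - q) s.
Proof.
rewrite idle_services_cat; have -> q' : idle_services q' (nseq a (true, s)) = [::].
  by elim: a q' => //= a IH q'.
rewrite cats0; elim: b q => [|b IH] [|q] //=; by rewrite IH ?subn0.
Qed.

Lemma site_word_cat A B ss1 ss2 :
  site_word A B (ss1 ++ ss2) = site_word A B ss1 ++ site_word A B ss2.
Proof. by rewrite /site_word map_cat flatten_cat. Qed.

Lemma site_word_cons A B s ss :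
  site_word A B (s :: ss) =
  (nseq (B s) (false, s) ++ nseq (A s) (true, s)) ++ site_word A B ss.
Proof. by []. Qed.

Lemma reverse_site_word A B ss :
  reverse_word (site_word A B ss) = site_word B A (rev ss).
Proof.
elim: ss => // s ss IH; rewrite site_word_cons reverse_word_cat IH rev_cons -cats1.
rewrite site_word_cat; congr (_ ++ _); rewrite /site_word /= cats0.
rewrite reverse_word_cat /reverse_word !map_nseq.
have rev_nseq m (c : bool * 'I_n) : rev (nseq m c) = nseq m c.
  by elim: m => // m IHm; rewrite rev_cons IHm -cats1 -(nseqD m 1) addn1.
by rewrite !rev_nseq.
Qed.

Lemma idle_services_notin q A B ss s :
  s \notin ss -> count_mem s (idle_services q (site_word A B ss)) = 0.
Proof.
elim: ss q => // t ss IH q; rewrite inE negb_or => /andP[ne_st nss].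
rewrite site_word_cons idle_services_cat idle_services_block count_cat IH //.
by rewrite count_nseq /= eq_sym (negPf ne_st).
Qed.

(** [p] is the predecessor map of the cyclic order in which [ss] lists the
    sites; the predecessor of the first entry is the last one. *)
Definition cyclic_pred (p : 'I_n -> 'I_n) ss : Prop :=
  forall s, (index (p s) ss).+1 = if index s ss is 0 then size ss else index s ss.

(** [q s] is the number of customers waiting once the block of brackets at [s]
    has been read; as the closing brackets come first in that block, the service
    there applies to the customers left over from the preceding site. *)
Lemma cyclic_queue_sites (p : 'I_n -> 'I_n) ss A B (u : seq 'I_n) :
    uniq ss -> (forall s, s \in ss) -> cyclic_pred p ss ->
    cyclic_queue (site_word A B ss) u ->
  exists q : 'I_n -> nat, forall s,
    q s = A s + (q (p s) - B s) /\ count_mem s u = B s - q (p s).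
Proof.
move=> uss mss pp [q0 q0K /permP qu].
pose before k := final_queue q0 (site_word A B (take k ss)).
exists (fun s => before (index s ss).+1) => s.
have -> : before (index (p s) ss).+1 = before (index s ss).
  rewrite pp; case: index => //.
  by rewrite /before take_size q0K take0.
rewrite -qu /before; move: uss; case/splitPr: (mss s) => ss1 ss2 uss.
have [ns1 ns2] : s \notin ss1 /\ s \notin ss2.
  by move: uss; rewrite cat_uniq /= negb_or => /and4P[_ /andP[? _] ? _].
rewrite index_cat (negPf ns1) /= eqxx addn0.
have -> : take (size ss1).+1 (ss1 ++ s :: ss2) = ss1 ++ [:: s].
  by rewrite -cat1s catA take_size_cat // size_cat addn1.
rewrite take_size_cat // !site_word_cat !site_word_cons [site_word _ _ [::]]/= cats0.
move: (fun q => final_queue_block q (A s) (B s) s).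
move: (fun q => idle_services_block q (A s) (B s) s).
move: (nseq _ _ ++ nseq _ _) => block idleE finalE.
rewrite !final_queue_cat !idle_services_cat finalE idleE.
rewrite !count_cat !idle_services_notin //.
by rewrite count_nseq /= eqxx; split=> //; lia.
Qed.

Lemma cyclic_pred_enum : cyclic_pred (@ord_pred n) (enum 'I_n).
Proof.
move=> s; rewrite !index_enum_ord size_enum_ord /=.
have := ltn_ord s; case: (nat_of_ord s) => [|m] lt_m.
  by rewrite add0n modn_small ?prednK.
by rewrite addSn /= modnDr modn_small // ltnW.
Qed.

Lemma cyclic_pred_rev_enum : cyclic_pred (@ordS n) (rev (enum 'I_n)).
Proof.
have index_rev (t : 'I_n) : index t (rev (enum 'I_n)) = n - t.+1.
  have lt_t := ltn_ord t.
  rewrite -[in LHS](nth_ord_enum t t) -[X in nth t _ X](subKn (ltnW lt_t)).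
  have -> : n - (n - t) = size (enum 'I_n) - (n - t.+1).+1.
    by rewrite size_enum_ord; lia.
  rewrite -nth_rev ?size_enum_ord; last lia.
  by rewrite index_uniq ?size_rev ?size_enum_ord ?rev_uniq ?enum_uniq //; lia.
move=> s; rewrite !index_rev size_rev size_enum_ord /=.
have := ltn_ord s; rewrite leq_eqVlt => /orP[/eqP last_s|lt_s].
  by rewrite last_s modnn subnn subn1 prednK // -last_s.
rewrite modn_small //; case E: (n - s.+1) => [|m]; lia.
Qed.

End SiteWords.

(** * The exchange of two rows as a queue *)

Section TwoRows.
Variable n : nat.
Implicit Types (A B : {mset 'I_n}%mset) (s a : 'I_n).

Definition swap_lower A B :=
  (A `\` unpaired_lower A B `+` unpaired_upper A B)%mset.
Definition swap_upper A B :=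
  (B `\` unpaired_upper A B `+` unpaired_lower A B)%mset.

(** Arrivals [A] and services [B] produce departures [B'], and the idle services
    are added to the arrivals to form [A']. *)
Definition queue_swap A B A' B' : Prop :=
  exists q : 'I_n -> nat, forall s,
    [/\ q s = A s + (q (ord_pred s) - B s),
        B' s = minn (B s) (q (ord_pred s)) :> nat & A' s + B' s = A s + B s].

(** The unmatched brackets are all of one kind, hence are a stationary queue
    of length zero when read forwards, or backwards, according to that kind. *)
Lemma queue_swap_rows A B :
  queue_swap A B (swap_lower A B) (swap_upper A B) \/
  queue_swap (swap_lower A B) (swap_upper A B) A B.
Proof.
have wordE : bracket_word A B = site_word A B (enum 'I_n) by [].
have idle_false (w : seq (bool * 'I_n)) :
    all (predC fst) w ->
    final_queue 0 w = 0 /\ idle_services 0 w = [seq c.2 | c <- w].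
  by elim: w => [|[[] s] w IH] //= /IH[-> ->].
case: (unmatched_uniform (bracket_word A B)) => uni; [right|left].
  have : cyclic_queue (reverse_word (unmatched (bracket_word A B)))
           (unpaired_lower A B).
    set w := unmatched _ in uni *.
    have/idle_false[w0 wu] : all (predC fst) (reverse_word w).
      by rewrite all_rev all_map; apply: sub_all uni => c /= ->.
    exists 0; rewrite // wu perm_sym (perm_trans (perm_eq_seq_mset _)) //.
    move/all_filterP: uni => ->.
    by rewrite map_rev -map_comp perm_sym perm_rev.
  move/cyclic_queue_reverse_unmatched; rewrite wordE reverse_site_word.
  have urev : uniq (rev (enum 'I_n)) by rewrite rev_uniq enum_uniq.
  have mrev s : s \in rev (enum 'I_n) by rewrite mem_rev mem_enum.
  case/(cyclic_queue_sites urev mrev (@cyclic_pred_rev_enum n)) => q qP.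
  have uB s : unpaired_upper A B s = 0.
    rewrite mset_seqE (eq_in_filter (a2 := pred0)) ?filter_pred0 //.
    by move=> c /(allP uni) /= ->.
  (* Here [q t] counts the pairs that straddle the cut before [t], because the
     word was read backwards; a forward queue counts those after [t]. *)
  exists (fun s => q (ordS s)) => s; rewrite ord_predK !msetE2 uB.
  have [-> ] := qP s; rewrite count_mem_mset => ->.
  by split; lia.
have : cyclic_queue (unmatched (bracket_word A B)) (unpaired_upper A B).
  have [w0 wu] := idle_false _ uni.
  exists 0; rewrite // wu perm_sym (perm_trans (perm_eq_seq_mset _)) //.
  by move/all_filterP: uni => ->.
move/cyclic_queue_unmatched; rewrite wordE.
case/(cyclic_queue_sites (enum_uniq _) (mem_enum _) (@cyclic_pred_enum n)) => q qP.
have uA s : unpaired_lower A B s = 0.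
  rewrite mset_seqE (eq_in_filter (a2 := pred0)) ?filter_pred0 //.
  by move=> c /(allP uni) /= /negPf ->.
exists q => s; rewrite !msetE2 uA.
have [-> ] := qP s; rewrite count_mem_mset => ->.
by split; lia.
Qed.

Lemma eq_leq_sum (f g : 'I_n -> nat) :
  (forall s, f s <= g s) -> \sum_s g s <= \sum_s f s -> f =1 g.
Proof.
move=> le_fg le_sum s; apply/eqP; rewrite eqn_leq le_fg /=.
move: le_sum; rewrite (bigD1 s) //= [X in _ <= X](bigD1 s) //=.
have le_rest : \sum_(t | t != s) f t <= \sum_(t | t != s) g t by apply: leq_sum.
by move=> /leq_trans/(_ (leq_add (leqnn (f s)) le_rest)); rewrite leq_add2r.
Qed.

(** The distance of two stationary solutions cannot grow from a site to the
    next one, so it is constant on the cycles of [p].  Where it is zero the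
    departures agree; where it is positive it survives the truncated subtraction
    only if both queues are at least [g], so that both departures are [g]. *)
Lemma queue_departure_unique (p : 'I_n -> 'I_n) (f g q q' : 'I_n -> nat) :
    injective p ->
    (forall s, q s = f s + (q (p s) - g s)) ->
    (forall s, q' s = f s + (q' (p s) - g s)) ->
  forall s, minn (g s) (q (p s)) = minn (g s) (q' (p s)).
Proof.
move=> p_inj qE q'E s.
pose d t := (q t - q' t) + (q' t - q t).
have /(_ s) : d =1 d \o p.
  apply: eq_leq_sum => [t|]; first by rewrite /d /= qE q'E; lia.
  by rewrite [X in _ <= X](reindex_inj p_inj).
by rewrite /d /= qE q'E; lia.
Qed.

Lemma queue_swap_uniquer A B A1 B1 A2 B2 :
  queue_swap A B A1 B1 -> queue_swap A B A2 B2 -> A1 = A2 /\ B1 = B2.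
Proof.
move=> [q qP] [q' q'P].
have eqB s : B1 s = B2 s.
  have [_ -> _] := qP s; have [_ -> _] := q'P s.
  apply: (queue_departure_unique (f := A) (@ord_pred_inj n)) => t.
    by case: (qP t).
  by case: (q'P t).
split; apply/msetP => s //.
by have [_ _ hA] := qP s; have [_ _ hA'] := q'P s; have := eqB s; lia.
Qed.

(** The relation is reversible: seen from the other side, with time running
    backwards, the departures [B] are the arrivals and [A] are the services. *)
Lemma queue_swap_uniquel A B A1 B1 A2 B2 :
  queue_swap A1 B1 A B -> queue_swap A2 B2 A B -> A1 = A2 /\ B1 = B2.
Proof.
move=> [q qP] [q' q'P].
have back q1 C E : (forall s, [/\ q1 s = C s + (q1 (ord_pred s) - E s),
      B s = minn (E s) (q1 (ord_pred s)) & A s + B s = C s + E s]) ->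
    forall s, q1 (ord_pred s) = B s + (q1 (ord_pred (ordS s)) - A s) /\
              C s = minn (A s) (q1 (ord_pred (ordS s))).
  by move=> h s; rewrite ordSK; have [] := h s; lia.
have eqA s : A1 s = A2 s.
  have [_ ->] := back _ _ _ qP s; have [_ ->] := back _ _ _ q'P s.
  pose f t := q (ord_pred t); pose f' t := q' (ord_pred t).
  apply: (queue_departure_unique (f := B) (q := f) (q' := f') (@ordS_inj n)) => t.
    by case: (back _ _ _ qP t).
  by case: (back _ _ _ q'P t).
split; apply/msetP => s //.
by have [_ _ hA] := qP s; have [_ _ hA'] := q'P s; have := eqA s; lia.
Qed.

(** Every customer departs: summing the recursion over the circle cancels the
    queue lengths. *)
Lemma queue_swap_sum A B A' B' : queue_swap A B A' B' ->
  (forall s, B' s <= B s) /\ \sum_s A s = \sum_s B' s.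
Proof.
case=> q qP; split=> [s|]; first by have [_ -> _] := qP s; rewrite geq_minl.
have: \sum_s (q s + B' s) = \sum_s (A s + q (ord_pred s)).
  by apply: eq_bigr => s _; have [] := qP s; lia.
rewrite !big_split /= [in LHS](reindex_inj (@ord_pred_inj n)) [LHS]addnC /=.
by move/addIn.
Qed.

(** [queue_swap] starts from rows with at least as many particles in the upper
    one and ends with rows where this is reversed.  Two steps in succession
    force the numbers to be equal, and then no service is idle. *)
Lemma queue_swap_twice A B A1 B1 A2 B2 :
  queue_swap A B A1 B1 -> queue_swap A1 B1 A2 B2 ->
  A = A1 /\ B = B1 /\ A1 = A2 /\ B1 = B2.
Proof.
move=> sw1 sw2.
have [leB1 sum1] := queue_swap_sum sw1; have [leB2 sum2] := queue_swap_sum sw2.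
have sums : \sum_s A1 s + \sum_s B1 s = \sum_s A s + \sum_s B s.
  by case: sw1 => q qP; rewrite -!big_split; apply: eq_bigr => s _; case: (qP s).
have le_sum1 : \sum_s B1 s <= \sum_s B s by apply: leq_sum.
have le_sum2 : \sum_s B2 s <= \sum_s B1 s by apply: leq_sum.
have eqB1 : B1 =1 B by apply: eq_leq_sum => //; lia.
have eqB2 : B2 =1 B1 by apply: eq_leq_sum => //; lia.
case: sw1 sw2 => [q qP] [q' q'P].
do !split; apply/msetP => s; have := eqB1 s; have := eqB2 s;
  by have [_ _ hA] := qP s; have [_ _ hA'] := q'P s; lia.
Qed.

(** Of the two directions offered by [queue_swap_rows], one is settled by
    uniqueness and the other by [queue_swap_twice]. *)
Lemma queue_swapE A B A' B' : queue_swap A B A' B' ->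
  [/\ swap_lower A B = A', swap_upper A B = B',
      swap_lower A' B' = A & swap_upper A' B' = B].
Proof.
move=> sw.
have [swl swu] : swap_lower A B = A' /\ swap_upper A B = B'.
  case: (queue_swap_rows A B) => sw'; first exact: queue_swap_uniquer sw' sw.
  by have [-> [-> [-> ->]]] := queue_swap_twice sw' sw.
have [swl' swu'] : swap_lower A' B' = A /\ swap_upper A' B' = B.
  case: (queue_swap_rows A' B') => sw'; last exact: queue_swap_uniquel sw' sw.
  by have [-> [-> [<- <-]]] := queue_swap_twice sw sw'.
by [].
Qed.

(** * A travelling site passes through two exchanged rows *)

Lemma move_one_in A s t x :
  0 < A s -> move_one A s t x = (x == t) + (A x - (x == s)) :> nat.
Proof. by move=> As; rewrite /move_one in_mset As mset1DE msetB1E. Qed.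

Lemma move_one_out A s t : A s = 0 -> move_one A s t = A.
Proof. by move=> As; rewrite /move_one in_mset As. Qed.

Definition next_site a A : 'I_n := if a \in A then ordS a else a.

Definition hop a A : {mset 'I_n}%mset := move_one A a (ordS a).

Lemma ordS_neq a : 1 < n -> ordS a != a.
Proof.
move=> n1; apply/eqP => /(congr1 val) /=; have := ltn_ord a.
rewrite leq_eqVlt => /orP[/eqP aE|lt_a]; last by rewrite modn_small //; lia.
by rewrite {1}aE modnn; lia.
Qed.

(** The site [a] moves a particle in both rows if [0 < A a] and
    [0 < B (ordS a)], in neither if [A a = B a = 0], and in exactly one
    otherwise.  The exchanged rows are in the same situation, which fixes the
    site of exit; but a single particle that moves in [B] may move in [A']
    instead of [B'], namely when the services at [a] are partly idle.  A queue
    length is affected only at [a], where a moved arrival or service takes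
    effect one site later, and at [ordS a], if both particles move. *)
Lemma queue_swap_hop a A B A' B' : queue_swap A B A' B' ->
  next_site (next_site a A') B' = next_site (next_site a A) B /\
  queue_swap (hop a A) (hop (next_site a A) B)
             (hop a A') (hop (next_site a A') B').
Proof.
move=> sw; case: (leqP n 1) => [n1|n1].
  (* With a single site nothing moves. *)
  have n_eq1 (s t : 'I_n) : s = t.
    by apply/val_inj => /=; have := ltn_ord s; have := ltn_ord t; lia.
  have hopE s C : hop s C = C.
    rewrite /hop (n_eq1 (ordS s) s) /move_one; case: ifP => // sC; exact: msetB1K.
  by rewrite !hopE.
case: sw => q qP.
have ne1 := ordS_neq a n1; have ne2 := ordS_neq (ordS a) n1.
have [qa B'a sa] := qP a; have [] := qP (ordS a); rewrite ordSK => qa1 B'a1 sa1.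
have predE s t : (ord_pred s == t) = (s == ordS t).
  by rewrite -(inj_eq (@ordS_inj n)) ord_predK.
have e01 : (a == ordS a) = false by rewrite eq_sym; apply/negbTE.
have e10 : (ordS a == a) = false by apply/negbTE.
have e12 : (ordS a == ordS (ordS a)) = false by rewrite eq_sym; apply/negbTE.
have memE (C : {mset 'I_n}%mset) x : (x \in C) = (0 < C x) by rewrite in_mset.
have around (P : 'I_n -> Prop) : P a -> P (ordS a) ->
    (forall s, (s == a) = false -> (s == ordS a) = false -> P s) -> forall s, P s.
  move=> Pa Pa1 Ps s; have [->//|ns] := eqVneq s a.
  by have [->//|ns1] := eqVneq s (ordS a); apply: Ps; apply/negbTE.
rewrite /next_site /hop !memE.
case: (posnP (A a)) => Aa; rewrite ?memE.
  case: (posnP (A' a)) => A'a; rewrite ?memE.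
    case: (posnP (B a)) => Ba; rewrite ?memE.
      have B'a0 : B' a = 0 by lia.
      by rewrite B'a0 !move_one_out //; split=> //; exists q.
    have B'a_gt0 : 0 < B' a by lia.
    rewrite B'a_gt0 !(move_one_out _ Aa) !(move_one_out _ A'a); split=> //.
    exists (fun s => q s + (s == a)); apply: around => [||s ns ns1];
      rewrite !move_one_in // !predE ?ordSK ?eqxx ?e01 ?e10 ?e12 ?ns ?ns1.
    - split; lia.
    - split; lia.
    - have [] := qP s; split; lia.
  have B'a1_0 : B' (ordS a) = 0 by lia.
  have Ba_gt0 : 0 < B a by lia.
  rewrite B'a1_0 Ba_gt0 (move_one_out _ Aa) (move_one_out _ B'a1_0); split=> //.
  exists q; apply: around => [||s ns ns1];
    rewrite !move_one_in // ?predE ?ordSK ?eqxx ?e01 ?e10 ?e12 ?ns ?ns1.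
  - split; lia.
  - split; lia.
  - have [] := qP s; split; lia.
have A'a : 0 < A' a by lia.
rewrite A'a.
case: (posnP (B (ordS a))) => Ba1; rewrite ?memE.
  have B'a1_0 : B' (ordS a) = 0 by lia.
  rewrite B'a1_0 (move_one_out _ Ba1) (move_one_out _ B'a1_0); split=> //.
  exists (fun s => q s - (s == a)); apply: around => [||s ns ns1];
    rewrite !move_one_in // !predE ?ordSK ?eqxx ?e01 ?e10 ?e12 ?ns ?ns1.
  - split; lia.
  - split; lia.
  - have [] := qP s; split; lia.
have B'a1_gt0 : 0 < B' (ordS a) by lia.
rewrite B'a1_gt0; split=> //.
exists (fun s => q s + (s == ordS a) - (s == a)); apply: around => [||s ns ns1];
  rewrite !move_one_in // !predE ?ordSK ?eqxx ?e01 ?e10 ?e12 ?ns ?ns1.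
- by case: (a == ordS (ordS a)); split; lia.
- split; lia.
- by case: (s == ordS (ordS a)); have [] := qP s; split; lia.
Qed.

(** Whichever of the two directions holds between the rows and their exchange,
    it still holds after the passage, and [queue_swapE] reads it either way. *)
Lemma swap_hop a A B (A1 := hop a A) (B1 := hop (next_site a A) B)
    (A' := swap_lower A B) (B' := swap_upper A B) :
  [/\ swap_lower A1 B1 = hop a A', swap_upper A1 B1 = hop (next_site a A') B'
    & next_site (next_site a A') B' = next_site (next_site a A) B].
Proof.
by case: (queue_swap_rows A B) => /(queue_swap_hop a)[eq_site /queue_swapE[]].
Qed.

End TwoRows.

(** * Inverting a passage *)

Section ManyRows.
Variable n : nat.
Implicit Types (A B : {mset 'I_n}%mset) (s a b : 'I_n).
Implicit Types (rows : seq {mset 'I_n}%mset).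

Definition prev_site A b : 'I_n := if ordS b \in A then ord_pred b else b.

Definition unhop b A : {mset 'I_n}%mset := move_one A (ordS b) b.

Lemma hop_unhop b A (a := ordS (prev_site A b)) :
  next_site a (unhop b A) = ordS b /\ hop a (unhop b A) = A.
Proof.
rewrite /a /prev_site /unhop /hop /next_site /move_one.
case: (boolP (ordS b \in A)) => [bA|/negbTE bA]; last by rewrite bA.
by rewrite ord_predK mset1D1 msetD1K msetB1K.
Qed.

Lemma unhop_hop a b A :
  next_site a A = ordS b ->
  ordS (prev_site (hop a A) b) = a /\ unhop b (hop a A) = A.
Proof.
rewrite /prev_site /unhop /hop /next_site /move_one.
case: (boolP (a \in A)) => [aA /ordS_inj <-|/negbTE aA eq_a].
  by rewrite mset1D1 ord_predK msetD1K msetB1K.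
by rewrite -eq_a aA.
Qed.

(** Pass back through [A], [B], apply [swap_hop] to the passage from there, and
    invert the passage through the exchanged rows. *)
Lemma swap_unhop b A B (A1 := unhop (prev_site B b) A) (B1 := unhop b B)
    (A' := swap_lower A B) (B' := swap_upper A B) :
  [/\ swap_lower A1 B1 = unhop (prev_site B' b) A',
      swap_upper A1 B1 = unhop b B'
    & prev_site A' (prev_site B' b) = prev_site A (prev_site B b)].
Proof.
have [siteB hopB] := hop_unhop b B; have [siteA hopA] := hop_unhop (prev_site B b) A.
set a := ordS _ in siteA hopA.
have := swap_hop a A1 B1; rewrite siteA siteB hopA hopB -/A' -/B'.
set A1' := swap_lower A1 B1; set B1' := swap_upper A1 B1 => -[eqA eqB out].
have [site2 unB] := unhop_hop out; rewrite -eqB in site2 unB.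
have [site1 unA] := unhop_hop (esym site2); rewrite -eqA in site1 unA.
by split=> //; apply: ordS_inj.
Qed.

(** * All rows *)

Fixpoint hops a rows :=
  if rows is A :: rows' then hop a A :: hops (next_site a A) rows' else [::].

Fixpoint unhops b rows :=
  if rows is A :: rows' then unhop (foldr prev_site b rows') A :: unhops b rows'
  else [::].

Lemma hops_cat a rows1 rows2 :
  hops a (rows1 ++ rows2) =
  hops a rows1 ++ hops (foldl (@next_site n) a rows1) rows2.
Proof. by elim: rows1 a => //= A rows1 IH a; rewrite IH. Qed.

Lemma unhops_cat b rows1 rows2 :
  unhops b (rows1 ++ rows2) =
  unhops (foldr prev_site b rows2) rows1 ++ unhops b rows2.
Proof. by elim: rows1 => //= A rows1 IH; rewrite IH foldr_cat. Qed.

Lemma size_hops a rows : size (hops a rows) = size rows.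
Proof. by elim: rows a => //= A rows IH a; rewrite IH. Qed.

Lemma size_unhops b rows : size (unhops b rows) = size rows.
Proof. by elim: rows => //= A rows ->. Qed.

Lemma tuple_eq_nth L (f : 'I_L -> {mset 'I_n}%mset) rows :
    size rows = L -> (forall k : 'I_L, f k = nth mset0 rows k) ->
  mktuple f = rows :> seq _.
Proof.
move=> sz fE; apply: (@eq_from_nth _ mset0) => [|k]; rewrite size_tuple ?sz // => lt_k.
by rewrite -(tnth_nth mset0 _ (Ordinal lt_k)) tnth_mktuple fE.
Qed.

Variable L : nat.
Implicit Types D : L.-tuple {mset 'I_n}%mset.

Lemma Ftilde_rows a D : Ftilde a D = hops a D :> seq _.
Proof.
apply: tuple_eq_nth => [|k]; first by rewrite size_hops size_tuple.
have : k < size D by rewrite size_tuple.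
rewrite /fwd_site /mlq_row /=; move: (k : nat) => {}k.
by elim: (tval D) a k => [|A rows IH] a [|k] //= /IH.
Qed.

Lemma Rtilde_rows b D : Rtilde b D = unhops b D :> seq _.
Proof.
apply: tuple_eq_nth => [|k]; first by rewrite size_unhops size_tuple.
have : k < size D by rewrite size_tuple.
rewrite /rev_site /mlq_row /=; move: (k : nat) => {}k.
by elim: (tval D) k => [|A rows IH] [|k] //= => [_|/IH //]; rewrite drop0.
Qed.

Lemma sigma_rows D rows1 rows2 A B :
    D = rows1 ++ [:: A, B & rows2] :> seq _ ->
  sigma (size rows1).+1 D =
  rows1 ++ [:: swap_lower A B, swap_upper A B & rows2] :> seq _.
Proof.
move=> DE; have sizeD := size_tuple D; rewrite DE size_cat /= in sizeD.
apply: tuple_eq_nth => [|k]; first by rewrite size_cat.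
rewrite /mlq_row DE /= !nth_cat ltnn ltnNge leqnSn /= subnn subSnn /=.
rewrite !eqSS; case: (ltngtP k (size rows1)) => [lt_k|lt_k|-> //]; last by rewrite subnn.
  by rewrite ltn_eqF // ltnW.
case: eqP => [->|ne_k]; first by rewrite subSnn.
have: k - size rows1 >= 2 by lia.
by case: (_ - _) => [|[|m]].
Qed.

End ManyRows.

Theorem proposition5p8 (n : nat) (hn : 1 <= n) (L : nat)
    (alpha : L.-tuple nat) (D : L.-tuple {mset 'I_n}%mset)
    (hD : D \in bMLQ alpha n) (i : 'I_n) (j : nat) (hj : 1 <= j < L) :
  sigma j (Ftilde i D) = Ftilde i (sigma j D) /\
  sigma j (Rtilde i D) = Rtilde i (sigma j D).
Proof.
case: j hj => [|k] // /andP[_ lt_kL].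
pose rows1 := take k D.
have sz1 : size rows1 = k by rewrite size_takel // size_tuple; lia.
have [A [B [rows2 DE]]] : exists A B rows2, D = rows1 ++ [:: A, B & rows2] :> seq _.
  exists (nth mset0 D k), (nth mset0 D k.+1), (drop k.+2 D).
  by rewrite -!drop_nth ?size_tuple ?cat_take_drop //; lia.
have sigmaD := sigma_rows DE; rewrite sz1 in sigmaD.
split; apply: val_inj.
  move: (Ftilde_rows i D) (Ftilde_rows i (sigma k.+1 D)).
  move: (Ftilde i D) (Ftilde i (sigma k.+1 D)) => F F'.
  rewrite sigmaD DE !hops_cat /= => FD ->.
  have [<- <- ->] := swap_hop (foldl (@next_site n) i rows1) A B.
  by move/sigma_rows: FD; rewrite size_hops sz1.
move: (Rtilde_rows i D) (Rtilde_rows i (sigma k.+1 D)).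
move: (Rtilde i D) (Rtilde i (sigma k.+1 D)) => R R'.
rewrite sigmaD DE !unhops_cat /= => RD ->.
have [<- <- ->] := swap_unhop (foldr (@prev_site n) i rows2) A B.
by move/sigma_rows: RD; rewrite size_unhops sz1.
Qed.
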